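(* For each $-D\le\zeta\le D$: (i) $\psi_\zeta V=\sum\tilde V^{\downarrow\uparrow}_{i,j}$, the sum over all ordered pairs $(i,j)$ with $0\le i,j\le D$ and $i+j=D+\zeta$; (ii) $\psi_\zeta V=\sum\tilde V^{\uparrow\downarrow}_{i,j}$, the sum over all ordered pairs $(i,j)$ with $0\le i,j\le D$ and $i+j=D-\zeta$.
   Context: Let $\Gamma=(X,R)$ be a finite, undirected, connected, distance-regular graph without loops or multiple edges, with path-length distance $\partial$ and diameter $D\ge3$. Let $V=\mathbb C X$ with Hermitian form $\langle u,v\rangle=u^t\overline v$. Let $E_0,\dots,E_D$ be the primitive idempotents of the Bose–Mesner algebra, ordered so that $\Gamma$ is $Q$-polynomial with respect to this ordering. Fix a vertex $x$ and let $E^*_i$ be the diagonal matrix with $(y,y)$-entry $1$ if $\partial(x,y)=i$, else $0$. Let $T$ be the subalgebra of $\mathrm{Mat}_X(\mathbb C)$ generated by the Bose–Mesner algebra and $E^*_0,\dots,E^*_D$. A $T$-module is a subspace $W\subseteq V$ with $TW\subseteq W$; it is irreducible if nonzero with no $T$-submodules other than $0,W$. For an irreducible $W$: its endpoint is $\rho=\min\{i:E^*_iW\ne0\}$, its dual endpoint is $\tau=\min\{i:E_iW\ne0\}$, its diameter is $d=|\{i:E^*_iW\ne0\}|-1$, and its displacement of the second kind is $\rho-\tau\in\{-D,\dots,D\}$. For $-D\le\zeta\le D$ let $V_\zeta$ be the span of the irreducible $T$-modules with displacement of the second kind $\zeta$; $V=\sum_\zeta V_\zeta$ is an orthogonal direct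 sum, and $\psi_\zeta$ is the projection of $V$ onto $V_\zeta$ (so $\psi_\zeta V=V_\zeta$). For $-1\le i,j\le D$: $V^{\uparrow\downarrow}_{i,j}=(E^*_DV+\dots+E^*_{D-i}V)\cap(E_0V+\dots+E_jV)$, $V^{\downarrow\uparrow}_{i,j}=(E^*_0V+\dots+E^*_iV)\cap(E_DV+\dots+E_{D-j}V)$ (zero if $i=-1$ or $j=-1$); for $0\le i,j\le D$, $\tilde V^{\mu\nu}_{i,j}$ is the orthogonal complement of $V^{\mu\nu}_{i-1,j}+V^{\mu\nu}_{i,j-1}$ in $V^{\mu\nu}_{i,j}$. *)

(* Defs.v *)
From HB Require Import structures.
From mathcomp Require Import all_boot all_order all_algebra.
From mathcomp Require Import boolp classical_sets reals.
From mathcomp.real_closed Require Export complex.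

Set Implicit Arguments.
Unset Strict Implicit.
Unset Printing Implicit Defensive.

Import Order.TTheory GRing.Theory Num.Theory.
Local Open Scope ring_scope.

Section Graph.
Variables (X : finType) (e : rel X).

(* In a connected graph a shortest path has fewer than #|X| edges; dist y z is
   #|X| when z cannot be reached from y. *)
Definition dist (y z : X) : nat :=
  find (fun k => [exists p : k.-tuple X, path e y p && (last y p == z)])
       (iota 0 #|X|).

Definition diam : nat := \max_(y : X) \max_(z : X) dist y z.

Definition distance_regular : Prop :=
  [/\ symmetric e, irreflexive e, (forall y z, connect e y z)
    & forall h i j : nat, exists p : nat, forall y z : X, dist y z = h ->
        #|[set w | (dist y w == i) && (dist w z == j)]| = p].

End Graph.

Section HermitianForm.
Variables (C : numClosedFieldType) (n : nat).

Definition hform (u v : 'cV[C]_n) : C := (u^T *m map_mx Num.conj v) 0 0.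

Fact hform_is_bilinear : bilinear_for
  (GRing.Scale.Law.clone _ _ *%R _)
  (GRing.Scale.Law.clone _ _ (Num.conj \; *%R) _) hform.
Proof.
split=> [v|u] a w z; rewrite /hform.
  by rewrite linearP /= mulmxDl -scalemxAl !mxE.
by rewrite map_mxD map_mxZ mulmxDr -scalemxAr !mxE.
Qed.

HB.instance Definition _ := bilinear_isBilinear.Build C
  'cV[C]_n 'cV[C]_n C _ _ hform hform_is_bilinear.

Fact hform_herm (u v : 'cV[C]_n) :
  hform u v = (-1) ^+ false * Num.conj (hform v u).
Proof.
rewrite expr0 mul1r /hform !mxE rmorph_sum /=; apply: eq_bigr => k _.
by rewrite !mxE rmorphM /= conjCK mulrC.
Qed.

HB.instance Definition _ := isHermitianSesquilinear.Build C
  'cV[C]_n false Num.conj hform hform_herm.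

(* The orthogonal complement of U in W. *)
Definition orthoc (U W : {vspace 'cV[C]_n}) : {vspace 'cV[C]_n} :=
  (W :&: orthov (@hform : {hermitian 'cV[C]_n for false & Num.conj}) U)%VS.

End HermitianForm.

Section Span.
Variables (K : fieldType) (vT : vectType K).

(* The span of a family of subspaces given as a predicate: its least upper
   bound for inclusion (vspanP). *)
Definition vspan (P : {vspace vT} -> Prop) : {vspace vT} :=
  xget 0%VS [set U | forall U' : {vspace vT},
                       (U <= U')%VS <-> forall W, P W -> (W <= U')%VS]%classic.

Lemma vspanP (P : {vspace vT} -> Prop) (U' : {vspace vT}) :
  (vspan P <= U')%VS <-> forall W, P W -> (W <= U')%VS.
Proof.
pose Q k := `[< exists2 U : {vspace vT}, \dim U = k
   & forall U', (forall W, P W -> (W <= U')%VS) -> (U <= U')%VS >].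
have Q0 : exists k, Q k.
  by exists 0%N; apply/asboolP; exists 0%VS => [|*]; rewrite ?dimv0 ?sub0v.
have Qb k : Q k -> (k <= \dim {:vT})%N.
  by move=> /asboolP[U <- _]; rewrite dimvS ?subvf.
rewrite /vspan; case: xgetP => [U _ |none]; first exact.
case: (ex_maxnP Q0 Qb) => k /asboolP[U dU ubU] kmax.
case: (none U) => U1; split=> [sUU1 W PW | ]; last exact: ubU.
suff /eqP UE : U == (U + W)%VS by rewrite (subv_trans _ sUU1)// UE addvSr.
rewrite eqEdim addvSl dU kmax//; apply/asboolP; exists (U + W)%VS => // U2 h.
by rewrite subv_add ubU // h.
Qed.

End Span.

Section Terwilliger.
Variables (C : numClosedFieldType) (X : finType) (e : rel X) (D : nat).

(* Mat_X(C) and V = C X, with rows and columns indexed through enum_val. *)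
Local Notation MatX := 'M[C]_#|X|.
Local Notation V := 'cV[C]_#|X|.

Definition dist_mx (i : nat) : MatX :=
  \matrix_(k, l) (dist e (enum_val k) (enum_val l) == i)%:R.

Definition bose_mesner : {vspace MatX} :=
  (\sum_(i < D.+1) <[dist_mx i]>)%VS.

(* E enumerates the primitive idempotents: the basis of the (commutative,
   semisimple) Bose-Mesner algebra made of mutually orthogonal idempotents
   with sum I. *)
Definition primitive_idempotents (E : 'I_D.+1 -> MatX) : Prop :=
  [/\ basis_of bose_mesner (codom E),
      (forall i j, E i *m E j = if i == j then E i else 0)
    & \sum_i E i = 1%:M].

(* q h i j is the Krein parameter q^h_{ij}, defined by
   E_i o E_j = |X|^-1 sum_h q^h_{ij} E_h (o the entrywise product). *)
Definition q_polynomial (E : 'I_D.+1 -> MatX) : Prop :=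
  exists q : 'I_D.+1 -> 'I_D.+1 -> 'I_D.+1 -> C,
  [/\ (forall i j, map2_mx *%R (E i) (E j) =
                   #|X|%:R^-1 *: \sum_h q h i j *: E h),
      (forall h i j : 'I_D.+1,
         [|| i + j < h, h + j < i | h + i < j]%N -> q h i j = 0)
    & (forall h i j : 'I_D.+1,
         [|| h == i + j :> nat, i == h + j :> nat | j == h + i :> nat]%N ->
         q h i j != 0)].

Variables (x : X) (E : 'I_D.+1 -> MatX).

Definition dual_idem (i : nat) : MatX :=
  \matrix_(k, l) ((k == l) && (dist e x (enum_val k) == i))%:R.

Inductive in_T : MatX -> Prop :=
| in_T_bose_mesner B : B \in bose_mesner -> in_T B
| in_T_dual_idem i : (i <= D)%N -> in_T (dual_idem i)
| in_T_lin a B B' : in_T B -> in_T B' -> in_T (a *: B + B')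
| in_T_mul B B' : in_T B -> in_T B' -> in_T (B *m B').

Definition Tmodule (W : {vspace V}) : Prop :=
  forall B, in_T B -> forall w, w \in W -> B *m w \in W.

Definition irreducible_Tmodule (W : {vspace V}) : Prop :=
  [/\ Tmodule W, W != 0%VS
    & forall U : {vspace V}, Tmodule U -> (U <= W)%VS -> U = 0%VS \/ U = W].

Definition mxact (B : MatX) (W : {vspace V}) : {vspace V} :=
  (linfun (mulmx B : V -> V) @: W)%VS.

(* The position in enum 'I_D.+1 = [:: 0; ...; D] is the index itself. *)
Definition endpoint (W : {vspace V}) : nat :=
  find (fun i : 'I_D.+1 => mxact (dual_idem i) W != 0%VS) (enum 'I_D.+1).

Definition dual_endpoint (W : {vspace V}) : nat :=
  find (fun i : 'I_D.+1 => mxact (E i) W != 0%VS) (enum 'I_D.+1).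

Definition displacement2 (W : {vspace V}) : int :=
  (endpoint W)%:Z - (dual_endpoint W)%:Z.

Definition Vdisp (zeta : int) : {vspace V} :=
  vspan (fun W => irreducible_Tmodule W /\ displacement2 W = zeta).

(* The projection onto Vdisp zeta attached to the direct sum decomposition of V
   into the Vdisp eta, - D <= eta <= D, with eta written k - D. *)
Definition psi (zeta : int) : 'End(V) :=
  daddv_pi (Vdisp zeta)
    (\sum_(k < (2 * D).+1 | (k%:Z - D%:Z != zeta)%R) Vdisp (k%:Z - D%:Z))%VS.

(* The indices i and j range over -1, ..., D; index -1 gives an empty sum. *)
Definition Vud (i j : int) : {vspace V} :=
  ((\sum_(k < D.+1 | (D%:Z - i <= k%:Z)%R) mxact (dual_idem k) fullv)
   :&: (\sum_(k < D.+1 | (k%:Z <= j)%R) mxact (E k) fullv))%VS.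

Definition Vdu (i j : int) : {vspace V} :=
  ((\sum_(k < D.+1 | (k%:Z <= i)%R) mxact (dual_idem k) fullv)
   :&: (\sum_(k < D.+1 | (D%:Z - j <= k%:Z)%R) mxact (E k) fullv))%VS.

Definition Vud_tilde (i j : int) : {vspace V} :=
  orthoc (Vud (i - 1) j + Vud i (j - 1))%VS (Vud i j).

Definition Vdu_tilde (i j : int) : {vspace V} :=
  orthoc (Vdu (i - 1) j + Vdu i (j - 1))%VS (Vdu i j).

End Terwilliger.

(* Main.v *)
Require Import Defs.
From mathcomp Require Import all_boot all_order all_algebra.
From mathcomp Require Import reals.
From mathcomp Require Import boolp zify ring.
Import Order.TTheory GRing.Theory Num.Theory.
Local Open Scope ring_scope.

(* Write F_i = E*_0 V + ... + E*_i V and G_k = E_k V + ... + E_D V, and let Y_c be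
   the sum of the F_i :&: G_k with i - k <= c. The adjacency matrix A and the dual
   adjacency matrix A* act tridiagonally on one family of eigenspaces and as
   scalars on the other, so (A - theta_k)(F_i :&: G_k) <= F_(i+1) :&: G_(k+1) and
   (A* - theta*_i)(F_i :&: G_k) <= F_(i-1) :&: G_(k-1); as A and A* generate T,
   every Y_c is a T-module. An irreducible module of displacement c lies in Y_c
   and is orthogonal to Y_(c-1), so V_c is the orthogonal complement of Y_(c-1)
   in Y_c. Since Y_(c-1) <= F_(i-1) + G_(k+1) when i - k = c, the spaces
   F_i :&: G_k :&: Y_(c-1) and F_(i-1) :&: G_k + F_i :&: G_(k+1) coincide, and the
   complement of the latter in F_i :&: G_k is orthogonal to Y_(c-1). Exchanging
   the families E and E* gives the second decomposition. *)

Set Implicit Arguments.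
Unset Strict Implicit.
Unset Printing Implicit Defensive.

(** * Orthogonal complements *)

Section Orthogonality.
Variables (C : numClosedFieldType) (n : nat).
Local Notation V := 'cV[C]_n.

Definition orthoC (U : {vspace V}) : {vspace V} :=
  orthov (@hform C n : {hermitian V for false & Num.conj}) U.

Lemma mem_orthoC (U : {vspace V}) (v : V) :
  reflect {in U, forall u, hform v u = 0} (v \in orthoC U).
Proof. exact: mem_orthovP. Qed.

Lemma orthocE (U W : {vspace V}) : orthoc U W = (W :&: orthoC U)%VS.
Proof. by []. Qed.

Lemma hform_eq0 (v : V) : hform v v = 0 -> v = 0.
Proof.
rewrite /hform mxE => /eqP; rewrite psumr_eq0 => [/allP h|k _]; last first.
  by rewrite !mxE mul_conjC_ge0.
apply/colP=> k; have := h k (mem_index_enum k).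
by rewrite !mxE /= mul_conjC_eq0 => /eqP.
Qed.

Lemma hform_adj (M : 'M[C]_n) (u v : V) : M^T = map_mx Num.conj M ->
  hform (M *m u) v = hform u (M *m v).
Proof. by move=> hM; rewrite /hform trmx_mul map_mxM -mulmxA hM. Qed.

Lemma orthoC_sym (U W : {vspace V}) : (U <= orthoC W)%VS = (W <= orthoC U)%VS.
Proof. exact: orthov_sym. Qed.

Lemma orthoCS (U W : {vspace V}) : (U <= W)%VS -> (orthoC W <= orthoC U)%VS.
Proof.
by move=> /subvP sUW; apply/subvP => v /mem_orthoC h; apply/mem_orthoC => u /sUW/h.
Qed.

Lemma capv_orthoC (U : {vspace V}) : (U :&: orthoC U = 0)%VS.
Proof.
apply/eqP; rewrite -subv0; apply/subvP=> v /memv_capP[vU /mem_orthoC h].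
by rewrite memv0; apply/eqP/hform_eq0/h.
Qed.

Lemma sub_orthoC_eq0 (U : {vspace V}) : (U <= orthoC U)%VS -> U = 0%VS.
Proof. by move=> /capv_idPl <-; exact: capv_orthoC. Qed.

(** Each further spanning vector cuts the dimension of the complement by at most one. Applied to a
    basis of [U], this bounds [\dim (orthoC U)] from below, which is what [addv_orthoC] needs. *)
Lemma dim_orthoC_span (us : seq V) :
  (\dim {:V} <= \dim (orthoC <<us>>) + size us)%N.
Proof.
elim: us => [|u us IH].
  by rewrite addn0 dimvS //; apply/subvP=> v _; apply/mem_orthoC=> w;
    rewrite span_nil memv0 => /eqP->; exact: linear0r.
have := leq_dim_orthov1 (@hform C n : {hermitian V for false & Num.conj})
  u (orthoC <<us>>).
suff -> : (orthoC <<us>> :&: orthov (@hform C n : {hermitian V for false & Num.conj})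
             <[u]>)%VS = orthoC <<u :: us>>.
  move=> h; apply: leq_trans IH _; rewrite -addSnnS leq_add2r.
  by rewrite -subn1 leq_subLR add1n in h.
apply/vspaceP=> v; rewrite memv_cap span_cons.
by rewrite -[LHS]andbC -orthovD.
Qed.

Lemma addv_orthoC (U : {vspace V}) : (U + orthoC U = fullv)%VS.
Proof.
apply/eqP; rewrite eqEdim subvf dimv_disjoint_sum ?capv_orthoC //=.
have := dim_orthoC_span (vbasis U).
by rewrite (span_basis (vbasisP U)) size_tuple addnC.
Qed.

Lemma orthoC_split (U : {vspace V}) (v : V) :
  exists u w, [/\ u \in U, w \in orthoC U & v = u + w].
Proof.
have: v \in (U + orthoC U)%VS by rewrite addv_orthoC memvf.
by case/memv_addP=> u uU [w wU ->]; exists u, w.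
Qed.

Lemma addv_orthoc (U W : {vspace V}) : (U <= W)%VS -> (U + orthoc U W = W)%VS.
Proof.
by move=> UW; rewrite orthocE capvC vspace_modl // addv_orthoC capfv.
Qed.
End Orthogonality.

(** * Flags of a system of orthogonal idempotents *)

(** Convertible with [mxact] but free of the graph, so [Vdu], [Vud] and the endpoints unfold to
    [low], [high] and [first_index]. *)
Definition mximg (C : numClosedFieldType) n (B : 'M[C]_n)
    (W : {vspace 'cV[C]_n}) : {vspace 'cV[C]_n} :=
  (linfun (mulmx B : 'cV[C]_n -> 'cV[C]_n) @: W)%VS.

Lemma mximgP (C : numClosedFieldType) n (B : 'M[C]_n) (W : {vspace 'cV[C]_n})
    (v : 'cV[C]_n) :
  reflect (exists2 w, w \in W & v = B *m w) (v \in mximg B W).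
Proof. by apply: (iffP memv_imgP) => -[w wW ->]; exists w; rewrite ?lfunE. Qed.

Lemma eq_vspan (K : fieldType) (vT : vectType K) (P P' : {vspace vT} -> Prop) :
  (forall W, P W <-> P' W) -> vspan P = vspan P'.
Proof. by move=> h; congr vspan; apply: funext => W; exact: propext. Qed.

Definition mxstable (C : numClosedFieldType) n (B : 'M[C]_n)
    (W : {vspace 'cV[C]_n}) : Prop :=
  forall w, w \in W -> B *m w \in W.


Lemma mxstable_sum (C : numClosedFieldType) n I (r : seq I) (a : I -> C)
    (B : I -> 'M[C]_n) (W : {vspace 'cV[C]_n}) :
  (forall i, mxstable (B i) W) -> mxstable (\sum_(i <- r) a i *: B i) W.
Proof.
move=> h w wW; rewrite mulmx_suml rpred_sum // => i _.
by rewrite -scalemxAl rpredZ // h.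
Qed.

Lemma mxstable_orthoC (C : numClosedFieldType) n (B : 'M[C]_n)
    (W : {vspace 'cV[C]_n}) : B^T = map_mx Num.conj B ->
  mxstable B W -> mxstable B (orthoC W).
Proof.
move=> hB sB v /mem_orthoC vW; apply/mem_orthoC => w wW.
by rewrite hform_adj // vW // sB.
Qed.

Section Flag.
Variables (C : numClosedFieldType) (n D : nat) (P : 'I_D.+1 -> 'M[C]_n).
Local Notation V := 'cV[C]_n.

Definition herm_idems : Prop :=
  [/\ forall i, (P i)^T = map_mx Num.conj (P i),
      forall i j, P i *m P j = if i == j then P i else 0
    & \sum_i P i = 1%:M].

Definition low (i : int) : {vspace V} :=
  (\sum_(k < D.+1 | (k%:Z <= i)%R) mximg (P k) fullv)%VS.

Definition high (i : int) : {vspace V} :=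
  (\sum_(k < D.+1 | (i <= k%:Z)%R) mximg (P k) fullv)%VS.

Definition first_index (W : {vspace V}) : nat :=
  find (fun i : 'I_D.+1 => mximg (P i) W != 0%VS) (enum 'I_D.+1).

Hypothesis hP : herm_idems.

Lemma idem_expand (v : V) : v = \sum_i P i *m v.
Proof. by case: hP => _ _ s1; rewrite -mulmx_suml s1 mul1mx. Qed.

(** Orthogonality of the idempotents turns membership in [low] and [high] into the vanishing of
    components, the form used from here on. *)
Lemma mem_idem_sum (p : pred 'I_D.+1) (v : V) :
  (v \in \sum_(k < D.+1 | p k) mximg (P k) fullv)%VS
    <-> forall k, ~~ p k -> P k *m v = 0.
Proof.
have [_ orth _] := hP; split=> [/memv_sumP[u uP ->] k npk|h].
  rewrite mulmx_sumr big1 // => j pj.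
  have /mximgP[w _ ->] := uP j pj; rewrite mulmxA orth.
  by case: eqP => [kj|]; rewrite ?mul0mx //; rewrite kj pj in npk.
rewrite (idem_expand v) (bigID p) /= [X in _ + X]big1 // addr0.
by apply: memv_sumr => k _; apply/mximgP; exists v; rewrite ?memvf.
Qed.

Lemma mem_low (i : int) (v : V) :
  v \in low i <-> forall k : 'I_D.+1, (i < k%:Z)%R -> P k *m v = 0.
Proof.
by rewrite mem_idem_sum; split=> h k ik; apply: h; rewrite ?ltNge // -ltNge in ik *.
Qed.

Lemma mem_high (i : int) (v : V) :
  v \in high i <-> forall k : 'I_D.+1, (k%:Z < i)%R -> P k *m v = 0.
Proof.
by rewrite mem_idem_sum; split=> h k ik; apply: h; rewrite ?ltNge // -ltNge in ik *.
Qed.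

Lemma lowS (i j : int) : i <= j -> (low i <= low j)%VS.
Proof.
move=> ij; apply/subvP => v /mem_low h; apply/mem_low => k jk; apply: h.
exact: le_lt_trans ij jk.
Qed.

Lemma highS (i j : int) : j <= i -> (high i <= high j)%VS.
Proof.
move=> ij; apply/subvP => v /mem_high h; apply/mem_high => k jk; apply: h.
exact: lt_le_trans jk ij.
Qed.

Lemma low_lt0 (i : int) : i < 0 -> low i = 0%VS.
Proof. by move=> i0; rewrite /low big_pred0 // => k; apply/negbTE; lia. Qed.

Lemma high_gt (i : int) : D%:Z < i -> high i = 0%VS.
Proof.
by move=> i0; rewrite /high big_pred0 // => k; have := ltn_ord k => ?; apply/negbTE; lia.
Qed.

Lemma low_min (i : int) : (low i <= low (Num.min i D%:Z))%VS.
Proof.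
apply/subvP => v /mem_low h; apply/mem_low => k; have := ltn_ord k.
by move=> *; apply: h; lia.
Qed.

Lemma high_max (i : int) : (high i <= high (Num.max i 0%:Z))%VS.
Proof. by apply/subvP => v /mem_high h; apply/mem_high => k *; apply: h; lia. Qed.

Lemma low_idem (i : 'I_D.+1) (v : V) : P i *m v \in low i%:Z.
Proof.
case: hP => _ orth _; apply/mem_low => k ik; rewrite mulmxA orth.
by case: eqP => [ki|_]; rewrite ?mul0mx //; move: ik; rewrite ki ltxx.
Qed.

(** In the expansion of [P k *m M *m v] as a sum of [P k *m M *m P j *m v], with [k] beyond [i + 1],
    either [j] exceeds [i] and the component of [v] vanishes, or the block of [M] does. *)
Lemma low_tridiag (M : 'M[C]_n) (i : int) (v : V) :
  (forall j k : 'I_D.+1, (j.+1 < k)%N || (k.+1 < j)%N -> P j *m M *m P k = 0) ->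
  v \in low i -> M *m v \in low (i + 1).
Proof.
move=> hM /mem_low hv; apply/mem_low => k ik.
rewrite [v]idem_expand !mulmx_sumr big1 // => j _.
have [ij|ij] := ltrP i j%:Z; first by rewrite hv ?mulmx0.
by rewrite !mulmxA hM ?mul0mx //; lia.
Qed.

Lemma high_tridiag (M : 'M[C]_n) (i : int) (v : V) :
  (forall j k : 'I_D.+1, (j.+1 < k)%N || (k.+1 < j)%N -> P j *m M *m P k = 0) ->
  v \in high i -> M *m v \in high (i - 1).
Proof.
move=> hM /mem_high hv; apply/mem_high => k ik.
rewrite [v]idem_expand !mulmx_sumr big1 // => j _.
have [ij|ij] := ltrP j%:Z i; first by rewrite hv ?mulmx0.
by rewrite !mulmxA hM ?mul0mx //; lia.
Qed.

Lemma idem_eigen (th : 'I_D.+1 -> C) (k : 'I_D.+1) (v : V) :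
  P k *m ((\sum_j th j *: P j) *m v) = th k *: (P k *m v).
Proof.
case: hP => _ orth _; rewrite mulmxA mulmx_sumr (bigD1 k) //= big1 ?addr0.
  by rewrite -scalemxAr orth eqxx scalemxAl.
by move=> j jk; rewrite -scalemxAr orth eq_sym (negbTE jk) scaler0.
Qed.

(** Subtracting [th i] kills exactly the top component, and the matrix does not mix components. *)
Lemma low_eigen (th : 'I_D.+1 -> C) (i : 'I_D.+1) (v : V) :
  v \in low i%:Z -> (\sum_j th j *: P j) *m v - th i *: v \in low (i%:Z - 1).
Proof.
move=> /mem_low hv; apply/mem_low => k ik.
rewrite mulmxBr idem_eigen -scalemxAr -scalerBl.
have [->|ki] := eqVneq k i; first by rewrite subrr scale0r.
rewrite hv ?scaler0 //; move: ki; rewrite -val_eqE /=; lia.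
Qed.

Lemma high_eigen (th : 'I_D.+1 -> C) (i : 'I_D.+1) (v : V) :
  v \in high i%:Z -> (\sum_j th j *: P j) *m v - th i *: v \in high (i%:Z + 1).
Proof.
move=> /mem_high hv; apply/mem_high => k ik.
rewrite mulmxBr idem_eigen -scalemxAr -scalerBl.
have [->|ki] := eqVneq k i; first by rewrite subrr scale0r.
rewrite hv ?scaler0 //; move: ki; rewrite -val_eqE /=; lia.
Qed.

Lemma first_indexP (W : {vspace V}) : W != 0%VS ->
  exists r : 'I_D.+1, [/\ first_index W = r,
    exists2 w, w \in W & P r *m w != 0
    & forall k : 'I_D.+1, (k < r)%N -> forall w, w \in W -> P k *m w = 0].
Proof.
move=> W0; set p := fun i : 'I_D.+1 => mximg (P i) W != 0%VS.
have hp : has p (enum 'I_D.+1).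
  apply: contraNT W0 => /hasPn h; rewrite -subv0; apply/subvP => w wW.
  rewrite (idem_expand w) memv0 big1 // => i _.
  have /negbNE/eqP e0 := h i (mem_enum _ i).
  by apply/eqP; rewrite -memv0 -e0; apply/mximgP; exists w.
have lt : (find p (enum 'I_D.+1) < D.+1)%N by rewrite -[X in (_ < X)%N]size_enum_ord -has_find.
exists (Ordinal lt); split => //.
  have /= := nth_find (Ordinal lt) hp.
  rewrite /p -[X in nth _ _ X]/(val (Ordinal lt)) nth_ord_enum.
  move=> /eqP h; apply: contrapT => h2; apply: h; apply/eqP; rewrite -subv0.
  apply/subvP=> _ /mximgP[w wW ->]; rewrite memv0; apply/eqP.
  by apply: contrapT => h3; apply: h2; exists w => //; apply/eqP.
move=> k /= kr w wW; have := before_find (Ordinal lt) kr.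
rewrite nth_ord_enum /p => /negbFE/eqP e0.
by apply/eqP; rewrite -memv0 -e0; apply/mximgP; exists w.
Qed.
End Flag.

(** * The displacement filtration *)

Section Displacement.
Variables (C : numClosedFieldType) (n D : nat) (P Q : 'I_D.+1 -> 'M[C]_n).
Local Notation V := 'cV[C]_n.

Definition PQmodule (W : {vspace V}) : Prop :=
  forall i, mxstable (P i) W /\ mxstable (Q i) W.

Definition PQirreducible (W : {vspace V}) : Prop :=
  [/\ PQmodule W, W != 0%VS
    & forall U : {vspace V}, PQmodule U -> (U <= W)%VS -> U = 0%VS \/ U = W].

Definition PQdisp (W : {vspace V}) : int :=
  (first_index P W)%:Z - (first_index Q W)%:Z.

(* With P = E* and Q = E, [PQcap i k] is the paper's V^(down,up)_(i,D-k); with P = E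
   and Q = E* it is V^(up,down)_(D-k,i). *)
Definition PQcap (i k : int) : {vspace V} := (low P i :&: high Q k)%VS.

Definition PQfilt (c : int) : {vspace V} :=
  (\sum_(i < D.+1) \sum_(k < D.+1 | (i%:Z - k%:Z <= c)%R) PQcap i%:Z k%:Z)%VS.

Definition PQtilde (i k : int) : {vspace V} :=
  orthoc (PQcap (i - 1) k + PQcap i (k + 1))%VS (PQcap i k).

(** The meeting point of the proof: [PQlayerE] writes it as a sum of spaces [PQtilde], and
    [vspan_dispE] as the span of the irreducible modules of displacement [c]. *)
Definition PQlayer (c : int) : {vspace V} :=
  (PQfilt c :&: orthoC (PQfilt (c - 1)))%VS.

Lemma PQmodule_add (U W : {vspace V}) :
  PQmodule U -> PQmodule W -> PQmodule (U + W)%VS.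
Proof.
move=> hU hW i; have [[hU1 hU2] [hW1 hW2]] := (hU i, hW i).
by split=> _ /memv_addP[u uU [w wW ->]]; rewrite mulmxDr memv_add; auto.
Qed.

Lemma PQmodule_cap (U W : {vspace V}) :
  PQmodule U -> PQmodule W -> PQmodule (U :&: W)%VS.
Proof.
move=> hU hW i; have [[hU1 hU2] [hW1 hW2]] := (hU i, hW i).
by split=> v /memv_capP[vU vW]; rewrite memv_cap; apply/andP; auto.
Qed.

(** The preimage of the span under a stabilizing matrix contains every member of the family, hence
    the span, by the universal property [vspanP]. *)
Lemma vspan_PQmodule (S : {vspace V} -> Prop) :
  (forall W, S W -> PQmodule W) -> PQmodule (vspan S).
Proof.
move=> hS i.
suff st (B : 'M[C]_n) : (forall W, S W -> mxstable B W) -> mxstable B (vspan S).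
  by split; apply: st => W /hS/(_ i)[].
move=> hB w wS; pose f := linfun (mulmx B : V -> V).
have : (vspan S <= f @^-1: vspan S)%VS.
  apply/vspanP => W SW; apply/subvP=> u uW; rewrite -memv_preim lfunE /=.
  have /vspanP/(_ W SW)/subvP : (vspan S <= vspan S)%VS by [].
  by apply; apply: hB.
by move=> /subvP/(_ w wS); rewrite -memv_preim lfunE.
Qed.

Lemma PQfiltS (c d : int) : c <= d -> (PQfilt c <= PQfilt d)%VS.
Proof.
move=> cd; apply/subv_sumP => i _; apply/subv_sumP => k ik.
by apply: (sumv_sup i) => //; apply: (sumv_sup k) => //; exact: le_trans cd.
Qed.

Hypotheses (hP : herm_idems P) (hQ : herm_idems Q).

Lemma PQmodule_orthoC (W : {vspace V}) : PQmodule W -> PQmodule (orthoC W).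
Proof.
move=> hW i; have [h1 h2] := hW i; case: hP => hhP _ _; case: hQ => hhQ _ _.
by split; apply: mxstable_orthoC.
Qed.

Lemma PQcapS (i j k l : int) : i <= j -> l <= k -> (PQcap i k <= PQcap j l)%VS.
Proof. by move=> ij lk; apply: capvS; [apply: lowS | apply: highS]. Qed.

(** [PQfilt] sums over indices in 0..D only. Outside this range [PQcap] is zero or unchanged when
    [i] is clipped down to [D] and [k] up to 0, and clipping only decreases [i - k]. *)
Lemma PQcap_sub_filt (c i k : int) : i - k <= c -> (PQcap i k <= PQfilt c)%VS.
Proof.
move=> ikc; have [i0|i0] := ltrP i 0.
  by rewrite /PQcap low_lt0 // cap0v sub0v.
have [Dk|kD] := ltrP D%:Z k; first by rewrite /PQcap high_gt // capv0 sub0v.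
have lti : (`|Num.min i D%:Z| < D.+1)%N by lia.
have ltk : (`|Num.max k 0| < D.+1)%N by lia.
apply: (@subv_trans _ _ (PQcap `|Num.min i D%:Z|%N%:Z `|Num.max k 0|%N%:Z)).
  by apply: capvS; rewrite gez0_abs; [exact: low_min | lia | exact: high_max | lia].
apply: (sumv_sup (Ordinal lti)) => //; apply: (sumv_sup (Ordinal ltk)) => //=.
lia.
Qed.

(* Components along a submodule stay inside every [PQcap], because the
   idempotents respect the decomposition W + orthoC W. *)
Lemma PQcap_split (W : {vspace V}) (i k : int) : PQmodule W ->
  (PQcap i k <= (W :&: PQcap i k) + (orthoC W :&: PQcap i k))%VS.
Proof.
move=> hW; have hW' := PQmodule_orthoC hW.
apply/subvP => v /memv_capP[vi vk].
move: vi vk => /(mem_low hP) vi /(mem_high hQ) vk.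
have [w [w' [wW w'W ve]]] := orthoC_split W v.
have z (B : 'M[C]_n) : mxstable B W -> mxstable B (orthoC W) -> B *m v = 0 ->
    B *m w = 0 /\ B *m w' = 0.
  move=> s1 s2; rewrite ve mulmxDr => /eqP; rewrite addr_eq0 => /eqP e.
  have : B *m w \in (W :&: orthoC W)%VS.
    by rewrite memv_cap s1 // e rpredN s2.
  rewrite capv_orthoC memv0 => /eqP e0; split=> //.
  by apply/eqP; rewrite -oppr_eq0 -e e0.
have zP l : P l *m v = 0 -> P l *m w = 0 /\ P l *m w' = 0.
  by have [[? _] [? _]] := (hW l, hW' l); exact: z.
have zQ l : Q l *m v = 0 -> Q l *m w = 0 /\ Q l *m w' = 0.
  by have [[_ ?] [_ ?]] := (hW l, hW' l); exact: z.
rewrite ve memv_add // memv_cap ?wW ?w'W /= memv_cap; apply/andP; split;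
  (apply/(mem_low hP) || apply/(mem_high hQ)) => l h.
- by have [] := zP l (vi l h).
- by have [] := zQ l (vk l h).
- by have [] := zP l (vi l h).
- by have [] := zQ l (vk l h).
Qed.

(** If [p - q < i - k], then [p <= i - 1] or [q >= k + 1]; so [v = a + b] with [a] in
    [low P (i - 1)] and [b] in [high Q (k + 1)]. Then [a = v - b] also lies in [high Q k], and
    [b = v - a] in [low P i]. *)
Lemma PQfilt_cap (i k c : int) : i - k = c ->
  (PQcap i k :&: PQfilt (c - 1) <= PQcap (i - 1) k + PQcap i (k + 1))%VS.
Proof.
move=> ikc; apply/subvP => v /memv_capP[/memv_capP[vi vk] vY].
have /subvP/(_ v vY)/memv_addP[a aF [b bG ve]] :
    (PQfilt (c - 1) <= low P (i - 1)%R + high Q (k + 1)%R)%VS.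
  apply/subv_sumP => p _; apply/subv_sumP => q pq.
  have [pi|ip] := ltrP p%:Z i.
    apply: (subv_trans (capvSl _ _)); apply: (subv_trans _ (addvSl _ _)).
    by apply: lowS => //; lia.
  apply: (subv_trans (capvSr _ _)); apply: (subv_trans _ (addvSr _ _)).
  by apply: highS => //; lia.
have ai : a \in low P i by apply: subvP aF; apply: lowS => //; lia.
have bk : b \in high Q k by apply: subvP bG; apply: highS => //; lia.
rewrite ve memv_add // memv_cap ?aF ?bG ?andbT /=.
  by rewrite -(addrK b a) -ve rpredB.
by rewrite -(addKr a b) -ve rpredD // rpredN.
Qed.

(** [a] and [b] abstract A and A*. The assumptions are symmetric under exchanging [P], [b], [ths]
    with [Q], [a], [th], so the section can be instantiated twice. *)
Variables (a b : 'M[C]_n) (th ths : 'I_D.+1 -> C).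
Hypotheses (aE : a = \sum_j th j *: Q j) (bE : b = \sum_j ths j *: P j).
Hypothesis aP : forall i j : 'I_D.+1,
  (i.+1 < j)%N || (j.+1 < i)%N -> P i *m a *m P j = 0.
Hypothesis bQ : forall i j : 'I_D.+1,
  (i.+1 < j)%N || (j.+1 < i)%N -> Q i *m b *m Q j = 0.
Hypothesis gen : forall W, mxstable a W -> mxstable b W -> PQmodule W.

Lemma PQfilt_module (c : int) : PQmodule (PQfilt c).
Proof.
have st (B : 'M[C]_n) : (forall i k : 'I_D.+1, i%:Z - k%:Z <= c ->
    forall v, v \in PQcap i%:Z k%:Z -> B *m v \in PQfilt c) -> mxstable B (PQfilt c).
  move=> hB w /memv_sumP[u uY ->]; rewrite mulmx_sumr rpred_sum // => i _.
  have /memv_sumP[u' u'Y ->] := uY i isT; rewrite mulmx_sumr rpred_sum // => k ik.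
  by apply: (hB i k) => //; apply: u'Y.
apply: gen; apply: st => i k ik v /memv_capP[vi vk].
  (* The part [a *m v - th k *: v] moves to [PQcap (i + 1) (k + 1)], with the same index difference;
     these indices may exceed [D], which [PQcap_sub_filt] allows. *)
  rewrite -[a *m v](subrK (th k *: v)) rpredD //.
    apply: (subvP (@PQcap_sub_filt c (i%:Z + 1) (k%:Z + 1) _)); first by lia.
    rewrite memv_cap rpredB /=.
    - by rewrite aE; apply: high_eigen.
    - exact: low_tridiag.
    - by rewrite rpredZ // (subvP (lowS hP _) _ vi) //; lia.
  by rewrite rpredZ // (subvP (PQcap_sub_filt ik)) // memv_cap vi.
rewrite -[b *m v](subrK (ths i *: v)) rpredD //.
  apply: (subvP (@PQcap_sub_filt c (i%:Z - 1) (k%:Z - 1) _)); first by lia.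
  rewrite memv_cap; apply/andP; split.
    by rewrite bE; apply: low_eigen.
  rewrite rpredB //; first exact: high_tridiag.
  by rewrite rpredZ // (subvP (highS hQ _) _ vk) //; lia.
by rewrite rpredZ // (subvP (PQcap_sub_filt ik)) // memv_cap vi.
Qed.

Lemma PQlayer_module (c : int) : PQmodule (PQlayer c).
Proof.
by apply: PQmodule_cap; [|apply: PQmodule_orthoC]; apply: PQfilt_module.
Qed.

(** Split [v] as [w + w'] along [PQfilt (c - 1)] and its complement. By [PQcap_split], [w] stays in
    [PQcap i k], hence by [PQfilt_cap] in the space to which [v] is orthogonal. Since [w'] is
    orthogonal to [w] as well, [hform w w = hform v w = 0]. *)
Lemma PQtilde_sub_layer (i k c : int) : i - k = c -> (PQtilde i k <= PQlayer c)%VS.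
Proof.
move=> ikc; apply/subvP => v /memv_capP[vik vo].
rewrite memv_cap (subvP (@PQcap_sub_filt c i k _)) ?ikc //=.
have /subvP/(_ v vik)/memv_addP[w /memv_capP[wY wik] [w' /memv_capP[w'Y _] ve]] :=
  PQcap_split i k (PQfilt_module (c - 1)).
have /(subvP (PQfilt_cap ikc)) wl : w \in (PQcap i k :&: PQfilt (c - 1))%VS.
  by rewrite memv_cap wik.
have e : hform w w = 0.
  move/mem_orthoC/(_ w wl): vo; rewrite ve linearDl /=.
  by move/mem_orthoC: w'Y => /(_ w wY) ->; rewrite addr0.
by rewrite ve (hform_eq0 e) add0r.
Qed.

Lemma PQlayerE (c : int) : PQlayer c =
  (\sum_(i < D.+1) \sum_(k < D.+1 | (i%:Z - k%:Z == c)%R) PQtilde i%:Z k%:Z)%VS.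
Proof.
set S := (X in _ = X); have SN : (S <= PQlayer c)%VS.
  apply/subv_sumP => i _; apply/subv_sumP => k /eqP ik; exact: PQtilde_sub_layer.
apply/eqP; rewrite eqEsubv SN andbT.
(* Only the summands with [i - k = c] are new; each is its [PQtilde] plus two spaces of index
   difference [c - 1]. *)
have YS : (PQfilt c <= S + PQfilt (c - 1)%R)%VS.
  apply/subv_sumP => i _; apply/subv_sumP => k ik.
  have [ikc|ikc] := eqVneq (i%:Z - k%:Z) c; last first.
    by apply: (subv_trans _ (addvSr _ _)); apply: PQcap_sub_filt; lia.
  rewrite -(@addv_orthoc _ _ (PQcap (i%:Z - 1) k%:Z + PQcap i%:Z (k%:Z + 1))%VS
    (PQcap i%:Z k%:Z)).
    rewrite addvC; apply: addvS.
      by apply: (sumv_sup i) => //; apply: (sumv_sup k) => //; apply/eqP.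
    by rewrite subv_add !PQcap_sub_filt //; lia.
  by rewrite subv_add !PQcapS //; lia.
have SO : (S <= orthoC (PQfilt (c - 1)%R))%VS := subv_trans SN (capvSr _ _).
apply: (@subv_trans _ _
  ((S + PQfilt (c - 1)%R) :&: orthoC (PQfilt (c - 1)%R))%VS).
  exact: capvS.
(* Modular law, as [S] lies in the complement of [PQfilt (c - 1)]. *)
by rewrite -vspace_modl // capv_orthoC addv0.
Qed.

Lemma PQirreducible_sub_layer (W : {vspace V}) :
  PQirreducible W -> (W <= PQlayer (PQdisp W))%VS.
Proof.
move=> [Wmod W0 Wirr]; rewrite /PQdisp.
have [r [-> [w wW rw] lt_r]] := first_indexP hP W0.
have [t [-> [u uW tu] lt_t]] := first_indexP hQ W0.
set c := r%:Z - t%:Z; rewrite subv_cap; apply/andP; split.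
  (* This submodule is nonzero: it contains [P r *m w], which lies in [low P r] and, like all of
     [W], in [high Q t]. *)
  have [||e|<-] := Wirr (W :&: PQfilt c)%VS; last exact: capvSr.
  - exact: PQmodule_cap Wmod (PQfilt_module _).
  - exact: capvSl.
  case/eqP: rw; apply/eqP; rewrite -memv0 -e memv_cap.
  have rwW : P r *m w \in W by have [h _] := Wmod r; apply: h.
  rewrite rwW (subvP (@PQcap_sub_filt c r%:Z t%:Z _)) //.
  rewrite memv_cap low_idem //=; apply/(mem_high hQ) => k kt.
  exact: lt_t.
have Ymod := PQfilt_module (c - 1); have W'mod := PQmodule_orthoC Wmod.
(* This is the orthogonal projection of [PQfilt (c - 1)] to [W]. If it is zero, [W] is orthogonal to
   [PQfilt (c - 1)]; it remains to exclude that it is all of [W]. *)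
have [||e|e] := Wirr (W :&: (PQfilt (c - 1)%R + orthoC W))%VS.
- by apply: PQmodule_cap => //; apply: PQmodule_add.
- exact: capvSl.
- rewrite orthoC_sym; apply/subvP => y yY.
  have [v [v' [vW v'W ye]]] := orthoC_split W y.
  suff /eqP v0 : v == 0 by rewrite ye v0 add0r.
  rewrite -memv0 -e memv_cap vW -(addrK v' v) -ye memv_add // rpredN //.
have /capv_idPl/subvP WY := e.
(* For [p - q < r - t], either [p < r] and [W] meets [PQcap p q] trivially, or [q > t]. So the
   projection lies in [high Q (t + 1)] and cannot contain [u], as [Q t *m u] is nonzero. *)
have Ysub : (PQfilt (c - 1)%R <= (W :&: high Q (t%:Z + 1)%R) + orthoC W)%VS.
  apply/subv_sumP => p _; apply/subv_sumP => q pq.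
  apply: (subv_trans (PQcap_split _ _ Wmod)); apply: addvS; last exact: capvSl.
  apply/subvP => v /memv_capP[vW /memv_capP[vp vq]].
  have [pr|rp] := ltnP p r.
    suff -> : v = 0 by exact: mem0v.
    rewrite (idem_expand hP v) big1 // => l _.
    have [lp|pl] := leqP l p; first by apply: lt_r => //; exact: leq_ltn_trans pr.
    by move/(mem_low hP): vp; apply; lia.
  by rewrite memv_cap vW (subvP (highS hQ _) _ vq) //; lia.
case/eqP: tu; have /memv_addP[y yY [v vW ue]] := WY _ uW.
have /memv_addP[z /memv_capP[zW zt] [v2 v2W ye]] := subvP Ysub _ yY.
have : u - z \in (W :&: orthoC W)%VS.
  by rewrite memv_cap rpredB //= ue ye -[z + _ + _]addrA [_ - z]addrC addKr rpredD.
rewrite capv_orthoC memv0 subr_eq0 => /eqP->.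
by move/(mem_high hQ): zt; apply; lia.
Qed.

Lemma PQlayer_ortho (c d : int) : c != d -> (PQlayer c <= orthoC (PQlayer d))%VS.
Proof.
wlog cd : c d / c < d => [h|_].
  by case: (ltgtP c d) => // [cd|dc] _; [|rewrite orthoC_sym]; apply: h;
    rewrite // ?lt_eqF.
rewrite orthoC_sym; apply: (subv_trans (capvSr _ _)); apply: orthoCS.
by apply: (subv_trans (capvSl _ _)); apply: PQfiltS; lia.
Qed.

Lemma ex_irreducible (W : {vspace V}) : PQmodule W -> W != 0%VS ->
  exists2 U, PQirreducible U & (U <= W)%VS.
Proof.
move: {-1}(\dim W) (leqnn (\dim W)) => m; elim: m W => [|m IH] W dW Wmod W0.
  by move: dW; rewrite leqn0 dimv_eq0 (negbTE W0).
have [irr|] := pselect (PQirreducible W); first by exists W.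
move=> nirr; have [U [Umod UW U0 UW']] : exists U : {vspace V},
    [/\ PQmodule U, (U <= W)%VS, U != 0%VS & U != W].
  apply: contrapT => h; apply: nirr; split=> // U Umod UW.
  apply: contrapT => h2; apply: h; exists U; split=> //; apply/eqP => e; apply: h2;
  by [left|right].
have [|U' irr U'U] := IH U _ Umod U0.
  rewrite -ltnS; apply: leq_trans dW; rewrite ltn_neqAle dimvS // andbT.
  by apply: contraNN UW' => /eqP e; rewrite eqEdim UW e leqnn.
by exists U' => //; exact: subv_trans UW.
Qed.

(** Otherwise the complement of the span in the layer contains an irreducible [W]. Displacement [c]
    would put [W] in the span, to which it is orthogonal; any other would put it in a layer
    orthogonal to [PQlayer c]. Either way [W] is orthogonal to itself. *)
Lemma vspan_dispE (c : int) :
  vspan (fun W => PQirreducible W /\ PQdisp W = c) = PQlayer c.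
Proof.
set S := vspan _; have SN : (S <= PQlayer c)%VS.
  by apply/vspanP => W [irr <-]; exact: PQirreducible_sub_layer.
have Smod : PQmodule S by apply: vspan_PQmodule => W [[]].
apply/eqP; rewrite eqEsubv SN /=.
have [/eqP e|n0] := boolP ((PQlayer c :&: orthoC S)%VS == 0%VS).
  rewrite -(addv_orthoc SN) orthocE e addv0 //.
have [|W irr] := ex_irreducible _ n0.
  by apply: PQmodule_cap; [exact: PQlayer_module | exact: PQmodule_orthoC].
rewrite subv_cap => /andP[WN WS].
have [[_ W0 _] Wd] := (irr, PQirreducible_sub_layer irr).
case/eqP: W0; apply: sub_orthoC_eq0.
have [dc|dc] := eqVneq (PQdisp W) c.
  apply: (subv_trans WS); apply: orthoCS.
  by have /vspanP : (S <= S)%VS by []; apply.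
apply: (subv_trans Wd); apply: (subv_trans (PQlayer_ortho dc)).
exact: orthoCS.
Qed.

Lemma vspan_disp_sum (c : int) :
  vspan (fun W => PQirreducible W /\ PQdisp W = c) =
  (\sum_(i < D.+1) \sum_(k < D.+1 | (i%:Z - k%:Z == c)%R) PQtilde i%:Z k%:Z)%VS.
Proof. by rewrite vspan_dispE PQlayerE. Qed.

Lemma vspan_disp_ortho (c d : int) : c != d ->
  (vspan (fun W => PQirreducible W /\ PQdisp W = c)
   <= orthoC (vspan (fun W => PQirreducible W /\ PQdisp W = d)))%VS.
Proof. by rewrite !vspan_dispE; exact: PQlayer_ortho. Qed.
End Displacement.

(** * Distances and the Bose-Mesner algebra *)

Section Distance.
Variables (X : finType) (e : rel X).
Local Open Scope nat_scope.

Lemma dist_le (y : X) (p : seq X) : path e y p -> dist e y (last y p) <= size p.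
Proof.
move=> ep; have [sp|ps] := ltnP (size p) #|X|; last first.
  by apply: leq_trans ps; rewrite -[X in _ <= X](size_iota 0) find_size.
rewrite leqNgt; apply/negP => lt; have := before_find 0 lt.
by rewrite nth_iota // add0n => /existsP[]; exists (in_tuple p); rewrite ep /=.
Qed.

Lemma dist_path (y z : X) : dist e y z < #|X| ->
  exists p, [/\ path e y p, last y p = z & size p = dist e y z].
Proof.
move=> lt; have := lt; rewrite -[X in _ < X -> _](size_iota 0) -has_find.
move=> /(nth_find 0); rewrite -/(dist e y z) nth_iota // add0n.
by case/existsP=> p /andP[ep /eqP ez]; exists p; rewrite size_tuple.
Qed.

Lemma dist_refl (y : X) : dist e y y = 0.
Proof. by apply/eqP; rewrite -leqn0; exact: (@dist_le y [::]). Qed.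

Hypotheses (e_sym : symmetric e) (e_irr : irreflexive e).
Hypothesis e_conn : forall y z, connect e y z.

Lemma dist_lt_card (y z : X) : dist e y z < #|X|.
Proof.
have /connectP[p ep ->] := e_conn y z; have [q eq uq _] := shortenP ep.
apply: leq_ltn_trans (dist_le eq) _.
by have := card_uniqP uq => /= <-; exact: max_card.
Qed.

Lemma dist_eq0 (y z : X) : dist e y z = 0 -> y = z.
Proof. by have [[|w p] [_ <- <-]] := dist_path (dist_lt_card y z). Qed.

Lemma dist_triangle (y z w : X) : dist e y w <= dist e y z + dist e z w.
Proof.
have [p [ep <- <-]] := dist_path (dist_lt_card y z).
have [q [eq <- <-]] := dist_path (dist_lt_card (last y p) w).
by rewrite -size_cat -last_cat dist_le // cat_path ep.
Qed.

Lemma dist_sym (y z : X) : dist e y z = dist e z y.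
Proof.
wlog suff le : y z / dist e y z <= dist e z y.
  by apply/eqP; rewrite eqn_leq !le.
have [p [ep <- <-]] := dist_path (dist_lt_card z y).
have := rev_path e z p; rewrite (eq_path (e' := e)); last by move=> ? ?; rewrite e_sym.
rewrite ep => /dist_le; rewrite size_rev size_belast.
by congr (dist _ _ _ <= _); case: p {ep} => //= w p; rewrite rev_cons last_rcons.
Qed.

Lemma dist_step (y z : X) (i : nat) : dist e y z = i.+1 ->
  exists w, dist e y w = 1 /\ dist e w z = i.
Proof.
move=> di; have [[|w p] []] := dist_path (dist_lt_card y z); first by rewrite di.
move=> /= /andP[yw ep] wz sp; exists w.
have d1 : dist e y w <= 1 by apply: (@dist_le y [:: w]); rewrite /= yw.
have d2 : dist e w z <= i by rewrite -wz; apply: leq_trans (dist_le ep) _; lia.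
have := dist_triangle y w z; rewrite di => tri.
suff : dist e y w != 0 by lia.
by apply/eqP => /dist_eq0 yw'; move: yw; rewrite yw' e_irr.
Qed.

Lemma dist_diam (y z : X) : dist e y z <= diam e.
Proof.
apply: leq_trans (leq_bigmax y).
exact: (leq_bigmax (F := fun z => dist e y z) z).
Qed.
End Distance.

Section Terwilliger.
Variables (C : numClosedFieldType) (X : finType) (e : rel X) (D : nat).
Local Notation MatX := 'M[C]_#|X|.
Local Notation V := 'cV[C]_#|X|.
Local Notation A := (dist_mx C e).

Hypotheses (dr : distance_regular e) (dD : diam e = D).

Let e_sym : symmetric e. Proof. by case: dr. Qed.
Let e_irr : irreflexive e. Proof. by case: dr. Qed.
Let e_conn y z : connect e y z. Proof. by case: dr. Qed.

Lemma dist_leD (y z : X) : (dist e y z <= D)%N.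
Proof. by rewrite -dD dist_diam. Qed.

Lemma sum_indic (h : nat) (F : nat -> C) : (h <= D)%N ->
  \sum_(i < D.+1) F i * (h == i)%:R = F h.
Proof.
move=> hD; rewrite (bigD1 (Ordinal (hD : (h < D.+1)%N))) //= eqxx mulr1 big1 ?addr0 //.
by move=> i; rewrite -val_eqE eq_sym /= => /negbTE->; rewrite mulr0.
Qed.

Lemma dist_mx0 : A 0 = 1%:M.
Proof.
apply/matrixP => k l; rewrite !mxE; congr (_%:R); congr nat_of_bool.
apply/eqP/eqP => [/dist_eq0 h|->]; last exact: dist_refl.
by apply: enum_val_inj; exact: h.
Qed.

(** [p h] is the intersection number for distances 1 and [i]. Its value is arbitrary when no two
    vertices are at distance [h], hence the guards [A h != 0]. *)
Lemma dist_mx_mul1 (i : nat) : exists p : nat -> nat,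
  [/\ A 1 *m A i = \sum_(h < D.+1) (p h)%:R *: A h,
      forall h, (i.+1 < h)%N -> A h != 0 -> p h = 0%N
    & A i.+1 != 0 -> p i.+1 != 0%N].
Proof.
have [_ _ _ /(_ _ 1%N i) reg] := dr; have [p pP] := choice reg.
have Ah h : A h != 0 -> exists y z, dist e y z = h.
  move=> A0; apply: contrapT => nex; case/eqP: A0; apply/matrixP => k l.
  rewrite !mxE; case: eqP => // kl; case: nex.
  by exists (enum_val k), (enum_val l).
exists p; split.
- apply/matrixP => k l; rewrite summxE mxE.
  under [RHS]eq_bigr do rewrite !mxE.
  rewrite (sum_indic (fun h => (p h)%:R)) ?dist_leD //.
  rewrite -(pP _ (enum_val k) (enum_val l) erefl) -[#|[set _ | _]|]sum1_card.
  rewrite (reindex_onto enum_rank enum_val) /=; last by move=> ? _; exact: enum_valK.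
  rewrite natr_sum [RHS]big_mkcond /=.
  rewrite (eq_bigl predT) => [|w]; last by rewrite enum_rankK eqxx.
  apply: eq_bigr => w _; rewrite !mxE enum_rankK inE -natrM mulnb.
  by case: andP.
- move=> h ih /Ah[y [z yz]]; rewrite -(pP _ _ _ yz).
  apply/eqP; rewrite cards_eq0; apply/eqP/setP => w; rewrite !inE.
  apply/negP => /andP[/eqP yw /eqP wz].
  have := dist_triangle e_conn y w z; lia.
- move=> /Ah[y [z yz]]; rewrite -(pP _ _ _ yz) cards_eq0.
  have [w [yw wz]] := dist_step e_irr e_conn yz.
  by apply/set0Pn; exists w; rewrite inE yw wz !eqxx.
Qed.

(** By induction: in the expansion of [A 1 *m A i], the term [A i.+1] has a nonzero coefficient and
    all other nonzero terms have smaller index. *)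
Lemma mxstable_dist_mx (W : {vspace V}) : mxstable (A 1) W ->
  forall i, (i <= D)%N -> mxstable (A i) W.
Proof.
move=> W1; elim/ltn_ind => -[|i] IH iD w wW; first by rewrite dist_mx0 mul1mx.
have [->|A0] := eqVneq (A i.+1) 0; first by rewrite mul0mx mem0v.
have [p [pE p0 pn0]] := dist_mx_mul1 i.
have : A 1 *m A i *m w \in W by rewrite -mulmxA W1 // IH // ltnW.
rewrite pE mulmx_suml (bigD1 (Ordinal (iD : (i.+1 < D.+1)%N))) //= -scalemxAl.
rewrite rpredDr; last first.
  apply: rpred_sum => h; rewrite -val_eqE /= => hi; rewrite -scalemxAl.
  have [/IH|ih] := ltnP h i.+1; first by move=> hW; rewrite rpredZ // hW // -ltnS.
  have [->|Ah] := eqVneq (A h) 0; first by rewrite mul0mx scaler0 mem0v.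
  by rewrite p0 ?scale0r ?mem0v //; lia.
move=> /(rpredZ ((p i.+1)%:R^-1)); rewrite scalerA mulVf ?scale1r //.
by rewrite pnatr_eq0 pn0.
Qed.
End Terwilliger.

(** The trace is the sum of the squared moduli of the entries of [M]. *)
Lemma mxtrace_adj_eq0 (C : numClosedFieldType) n (M : 'M[C]_n) :
  \tr (M *m (map_mx Num.conj M)^T) = 0 -> M = 0.
Proof.
rewrite /mxtrace => /eqP; have ge0 k : 0 <= (M *m (map_mx Num.conj M)^T) k k.
  by rewrite mxE sumr_ge0 // => l _; rewrite !mxE mul_conjC_ge0.
rewrite psumr_eq0 // => /allP h; apply/matrixP => k l.
have /= := h k (mem_index_enum k); rewrite mxE psumr_eq0 => [/allP h2|j _].
  by have /= := h2 l (mem_index_enum l); rewrite !mxE mul_conjC_eq0 => /eqP.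
by rewrite !mxE mul_conjC_ge0.
Qed.

Lemma memv_sum_lineP (K : fieldType) (vT : vectType K) (I : finType)
    (B : I -> vT) (v : vT) :
  v \in (\sum_i <[B i]>)%VS -> exists t : I -> K, v = \sum_i t i *: B i.
Proof.
move=> /memv_sumP[u uB ->].
have /choice[t tE] : forall i, exists c, u i = c *: B i by move=> i; exact/vlineP/uB.
by exists t; apply: eq_bigr.
Qed.

(** * Primitive idempotents, their duals and the Krein parameters *)

Section Idempotents.
Variables (C : numClosedFieldType) (X : finType) (e : rel X) (D : nat).
Variables (x : X) (E : 'I_D.+1 -> 'M[C]_#|X|).
Local Notation MatX := 'M[C]_#|X|.
Local Notation V := 'cV[C]_#|X|.
Local Notation A := (dist_mx C e).
Local Notation M := (bose_mesner C e D).
Local Notation conj_mx := (map_mx Num.conj).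

Hypotheses (dr : distance_regular e) (dD : diam e = D).
Hypothesis (hE : primitive_idempotents e E).

Lemma mem_bose_mesner (B : MatX) : B \in M <->
  exists s : nat -> C, forall k l, B k l = s (dist e (enum_val k) (enum_val l)).
Proof.
split=> [/memv_sum_lineP[t ->]|[s sE]].
  exists (fun h : nat => \sum_(i < D.+1) t i * (h == i :> nat)%:R) => k l.
  by rewrite summxE; apply: eq_bigr => i _; rewrite !mxE.
have -> : B = \sum_(i < D.+1) s i *: A i.
  apply/matrixP => k l; rewrite sE summxE -[LHS](sum_indic s (dist_leD dD _ _)).
  by apply: eq_bigr => i _; rewrite !mxE.
by apply: memv_sumr => i _; rewrite memvZ ?memv_line.
Qed.

Lemma dist_mx_bm (i : nat) : A i \in M.
Proof. by apply/mem_bose_mesner; exists (fun h : nat => (h == i)%:R) => k l; rewrite mxE. Qed.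

Lemma bm_expand_dist (B : MatX) : B \in M ->
  exists s : 'I_D.+1 -> C, B = \sum_i s i *: A i.
Proof. exact: memv_sum_lineP. Qed.

Lemma bm_expand (B : MatX) : B \in M ->
  exists t : 'I_D.+1 -> C, B = \sum_j t j *: E j.
Proof.
case: hE => bE _ _; rewrite -(span_basis bE) span_def /codom big_map big_enum /=.
exact: memv_sum_lineP.
Qed.

Lemma idem_bm (j : 'I_D.+1) : E j \in M.
Proof. by case: hE => bE _ _; rewrite (basis_mem bE) // codom_f. Qed.

Lemma idem_neq0 (j : 'I_D.+1) : E j != 0.
Proof.
case: hE => /andP[_ /free_not0 f] _ _; apply: f; exact: codom_f.
Qed.

Lemma bm_tr (B : MatX) : B \in M -> B^T = B.
Proof.
case: dr => e_sym _ e_conn _ /mem_bose_mesner[s sE].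
by apply/matrixP => k l; rewrite mxE !sE dist_sym.
Qed.

Lemma bm_conj (B : MatX) : B \in M -> conj_mx B \in M.
Proof.
move=> /mem_bose_mesner[s sE]; apply/mem_bose_mesner.
by exists (Num.conj \o s) => k l; rewrite mxE sE.
Qed.

(* conj E_j is an idempotent of the algebra, hence a sum of some of the E_i; as
   E_j is symmetric, E_j conj(E_j) = E_j E_j^* is nonzero, so E_j occurs in it
   and conversely. *)
Lemma idem_real (j : 'I_D.+1) : conj_mx (E j) = E j.
Proof.
have [_ orth _] := hE.
have [t tE] := bm_expand (bm_conj (idem_bm j)).
have mulE : E j *m conj_mx (E j) = t j *: E j.
  rewrite tE mulmx_sumr (bigD1 j) //= big1 ?addr0 => [|i ij].
    by rewrite -scalemxAr orth eqxx.
  by rewrite -scalemxAr orth eq_sym (negbTE ij) scaler0.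
have mulE' : conj_mx (E j) *m E j = t j *: E j.
  rewrite tE mulmx_suml (bigD1 j) //= big1 ?addr0 => [|i ij].
    by rewrite -scalemxAl orth eqxx.
  by rewrite -scalemxAl orth (negbTE ij) scaler0.
have t0 : t j != 0.
  apply: contraNneq (idem_neq0 j) => t0; apply/eqP/mxtrace_adj_eq0.
  by rewrite (bm_tr (bm_conj (idem_bm j))) mulE t0 scale0r mxtrace0.
have t1 : t j = 1.
  have : conj_mx (E j) *m conj_mx (E j) *m E j = t j *: E j.
    by rewrite -map_mxM orth eqxx mulE'.
  rewrite -mulmxA mulE' -scalemxAr mulE' scalerA => /eqP.
  rewrite -subr_eq0 -scalerBl scaler_eq0 (negbTE (idem_neq0 j)) orbF.
  by rewrite -{3}[t j]mulr1 -mulrBr mulf_eq0 (negbTE t0) subr_eq0 => /eqP.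
rewrite t1 scale1r in mulE mulE'.
have conj2 : conj_mx (conj_mx (E j)) = E j.
  by apply/matrixP => k l; rewrite !mxE conjCK.
by rewrite -{1}mulE' map_mxM conj2 mulE.
Qed.

Lemma idem_herm : herm_idems E.
Proof.
by have [_ orth s1] := hE; split=> // i; rewrite idem_real bm_tr ?idem_bm.
Qed.

Local Notation x0 := (enum_rank x).
(** A linear map taking entrywise products to matrix products. It sends [A i] to E*_i, and [E j] to
    the j-th dual distance matrix divided by |X|. *)
Definition dual_mx (B : MatX) : MatX := diag_mx (row x0 B).

Lemma dual_mx_sum I (r : seq I) (t : I -> C) (B : I -> MatX) :
  dual_mx (\sum_(i <- r) t i *: B i) = \sum_(i <- r) t i *: dual_mx (B i).
Proof.
rewrite /dual_mx linear_sum linear_sum /=.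
by apply: eq_bigr => i _; rewrite !linearZ.
Qed.

Lemma dual_mx_mul (B B' : MatX) :
  dual_mx B *m dual_mx B' = dual_mx (map2_mx *%R B B').
Proof.
rewrite /dual_mx mulmx_diag; congr diag_mx.
by apply/rowP => k; rewrite !mxE.
Qed.

Lemma dual_idemE (i : nat) : dual_idem C e x i = dual_mx (A i).
Proof.
apply/matrixP => k l; rewrite !mxE enum_rankK.
by case: eqP => [->|_]; rewrite ?mulr0n ?mulr1n //=.
Qed.

Lemma dual_idem_herm : herm_idems (fun i : 'I_D.+1 => dual_idem C e x i).
Proof.
split=> [i|i j|].
- apply/matrixP => k l; rewrite !mxE conjC_nat eq_sym.
  by case: eqP => // ->.
- rewrite !dual_idemE dual_mx_mul; have [->|ij] := eqVneq i j.
    congr dual_mx; apply/matrixP => k l; rewrite !mxE -natrM mulnb.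
    by rewrite andbb.
  apply/matrixP => k l; rewrite !mxE -natrM mulnb.
  case: eqP => [->|]; last by rewrite mul0rn.
  by rewrite val_eqE (negbTE ij) mul0rn.
- apply/matrixP => k l; rewrite summxE.
  under eq_bigr => i _ do rewrite dual_idemE !mxE enum_rankK.
  rewrite mxE; case: eqP => [->|_]; last by rewrite big1.
  under eq_bigr => i _ do rewrite mulr1n -[_%:R]mul1r.
  by rewrite (sum_indic (fun=> 1)) // dist_leD.
Qed.

(** A nonzero entry would join vertices at mutual distance 1 whose distances to [x] are [i] and [j],
    against the triangle inequality. *)
Lemma dual_idem_tridiag (i j : 'I_D.+1) : (i.+1 < j)%N || (j.+1 < i)%N ->
  dual_idem C e x i *m A 1 *m dual_idem C e x j = 0.
Proof.
move=> ij; rewrite !dual_idemE mul_diag_mx mul_mx_diag; apply/matrixP => k l.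
rewrite !mxE !enum_rankK -!natrM !mulnb; case: andP => // -[/andP[/eqP xk /eqP kl] /eqP xl].
case: dr => e_sym _ e_conn _.
have := dist_triangle e_conn x (enum_val k) (enum_val l).
have := dist_triangle e_conn x (enum_val l) (enum_val k).
by rewrite (dist_sym e_sym e_conn (enum_val l)) xk kl xl; lia.
Qed.

Variable q : 'I_D.+1 -> 'I_D.+1 -> 'I_D.+1 -> C.
Hypothesis qE : forall i j, map2_mx *%R (E i) (E j) =
  #|X|%:R^-1 *: \sum_h q h i j *: E h.

(** The squared norm of the product is the (x,x) entry of E_h (E_i o E_j) E_h, that is, of |X|^-1
    q^h_{ij} E_h. *)
Lemma idem_dual_idem_eq0 (h i j : 'I_D.+1) : q h i j = 0 ->
  E i *m dual_mx (E h) *m E j = 0.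
Proof.
move=> q0; have [_ orth _] := hE; set b := dual_mx (E h).
have bconj : conj_mx b = b.
  rewrite /b /dual_mx map_diag_mx map_row idem_real //.
have btr : b^T = b by rewrite tr_diag_mx.
apply: mxtrace_adj_eq0; rewrite !map_mxM !trmx_mul !idem_real bconj btr.
rewrite !bm_tr ?idem_bm // !mulmxA -[E i *m b *m E j *m E j]mulmxA orth eqxx.
rewrite mxtrace_mulC !mulmxA orth eqxx.
transitivity ((E h *m map2_mx *%R (E i) (E j) *m E h) x0 x0).
  rewrite /mxtrace [RHS]mxE.
  under eq_bigr => k _.
    rewrite mul_mx_diag mxE mxE mulr_suml.
    under eq_bigr => l _ do rewrite mul_mx_diag !mxE.
    over.
  rewrite exchange_big /=; apply: eq_bigr => l _; rewrite mxE mulr_suml.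
  apply: eq_bigr => k _; rewrite !mxE.
  have sy (m : 'I_D.+1) u v : E m u v = E m v u.
    by rewrite -{1}(bm_tr (idem_bm m)) mxE.
  by rewrite (sy j l k) (sy h l x0); ring.
rewrite qE -scalemxAr -scalemxAl mulmx_sumr mulmx_suml big1 ?scaler0 ?mxE // => m _.
rewrite -scalemxAr orth; case: eqP => [<-|_]; last by rewrite scaler0 mul0mx.
by rewrite q0 scale0r mul0mx.
Qed.

Hypothesis q_eq0 : forall h i j : 'I_D.+1,
  [|| i + j < h, h + j < i | h + i < j]%N -> q h i j = 0.
Hypothesis q_neq0 : forall h i j : 'I_D.+1,
  [|| h == i + j :> nat, i == h + j :> nat | j == h + i :> nat]%N ->
  q h i j != 0.

Lemma card_neq0 : #|X|%:R != 0 :> C.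
Proof. by rewrite pnatr_eq0 -lt0n; apply/card_gt0P; exists x. Qed.

Lemma idem0_mul (j : 'I_D.+1) :
  map2_mx *%R (E ord0) (E j) = (#|X|%:R^-1 * q j ord0 j) *: E j.
Proof.
rewrite qE (bigD1 j) //= big1 ?addr0 ?scalerA // => h hj.
rewrite q_eq0 ?scale0r //; move: hj; rewrite -val_eqE /=; lia.
Qed.

(* E_0 acts on every E_j entrywise as a nonzero scalar, so a zero entry of E_0
   would be a zero entry of the whole algebra. *)
Lemma idem0_const (k l : 'I_#|X|) : E ord0 k l = #|X|%:R^-1 * q ord0 ord0 ord0.
Proof.
have mulE j : E ord0 k l * E j k l = #|X|%:R^-1 * q j ord0 j * E j k l.
  by have /matrixP/(_ k l) := idem0_mul j; rewrite !mxE.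
have [e0|n0] := eqVneq (E ord0 k l) 0; last exact: (mulIf n0 (mulE ord0)).
have Ej0 j : E j k l = 0.
  have /eqP := mulE j; rewrite e0 mul0r eq_sym !mulf_eq0 invr_eq0.
  rewrite (negbTE card_neq0) (negbTE (q_neq0 _)) /=; last by rewrite !add0n addn0 eqxx orbT.
  by move/eqP.
have [t tE] := bm_expand (dist_mx_bm (dist e (enum_val k) (enum_val l))).
have /matrixP/(_ k l) := tE; rewrite mxE eqxx summxE big1 => [/eqP|j _].
  by rewrite oner_eq0.
by rewrite mxE Ej0 mulr0.
Qed.

(** Dual to [mxstable_dist_mx]: the expansion of E_1 o E_i has a nonzero coefficient at E_(i+1) and
    none beyond. The induction starts from E_0, whose entries are constant, so that its dual is
    scalar. *)
Lemma mxstable_dual_mx (one : 'I_D.+1) (W : {vspace V}) : one = 1%N :> nat ->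
  mxstable (dual_mx (E one)) W -> forall j, mxstable (dual_mx (E j)) W.
Proof.
move=> one1 W1 j; have [m jm] : exists m, j = m :> nat by exists j.
elim/ltn_ind: m j jm => -[|i] IH j jm w wW.
  suff -> : dual_mx (E j) = (#|X|%:R^-1 * q ord0 ord0 ord0)%:M.
    by rewrite mul_scalar_mx rpredZ.
  have -> : j = ord0 by apply: val_inj.
  rewrite /dual_mx -diag_const_mx; congr diag_mx.
  by apply/rowP => k; rewrite !mxE idem0_const.
have iD : (i < D.+1)%N by apply: ltn_trans (ltn_ord j); rewrite jm.
pose i' := Ordinal iD.
have : dual_mx (E one) *m dual_mx (E i') *m w \in W.
  by rewrite -mulmxA W1 // (IH i).
rewrite dual_mx_mul qE scaler_sumr; under eq_bigr do rewrite scalerA.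
rewrite dual_mx_sum mulmx_suml (bigD1 j) //= -scalemxAl.
rewrite rpredDr; last first.
  apply: rpred_sum => h hj; rewrite -scalemxAl.
  have [hi|ih] := ltnP h i.+1; first by rewrite rpredZ // (IH h).
  rewrite q_eq0 ?mulr0 ?scale0r ?mem0v // one1 /=.
  by move: hj; rewrite -val_eqE /= jm; lia.
have c0 : #|X|%:R^-1 * q j one i' != 0.
  by rewrite mulf_neq0 ?invr_eq0 ?card_neq0 // q_neq0 // one1 jm /= add1n eqxx.
by move=> /(rpredZ (#|X|%:R^-1 * q j one i')^-1); rewrite scalerA mulVf ?scale1r.
Qed.
End Idempotents.

(** * The two decompositions for the Terwilliger algebra *)

Section Decomposition.
Variables (C : numClosedFieldType) (X : finType) (e : rel X) (D : nat).
Variables (x : X) (E : 'I_D.+1 -> 'M[C]_#|X|).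
Local Notation V := 'cV[C]_#|X|.

Hypotheses (dr : distance_regular e) (dD : diam e = D) (D_gt0 : (0 < D)%N).
Hypotheses (hE : primitive_idempotents e E) (hq : q_polynomial E).

Let Es (i : 'I_D.+1) : 'M[C]_#|X| := dual_idem C e x i.
Let one : 'I_D.+1 := Ordinal (D_gt0 : (1 < D.+1)%N).
Let a : 'M[C]_#|X| := dist_mx C e 1.
Let b : 'M[C]_#|X| := dual_mx x (E one).
Let hEs : herm_idems Es := dual_idem_herm C x dD.
Let hE' : herm_idems E := idem_herm dr dD hE.

Let aE : exists th, a = \sum_j th j *: E j.
Proof. by have [t tE] := bm_expand hE (dist_mx_bm C dD 1); exists t. Qed.

Let bE : exists ths, b = \sum_j ths j *: Es j.
Proof.
have [s sE] := bm_expand_dist (idem_bm hE one).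
by exists s; rewrite /b sE dual_mx_sum; under eq_bigr do rewrite -dual_idemE.
Qed.

Let aEs (i j : 'I_D.+1) : (i.+1 < j)%N || (j.+1 < i)%N -> Es i *m a *m Es j = 0.
Proof. exact: dual_idem_tridiag. Qed.

Let bE0 (i j : 'I_D.+1) : (i.+1 < j)%N || (j.+1 < i)%N -> E i *m b *m E j = 0.
Proof.
case: hq => q [qE q0 _] ij; rewrite /b; apply: (idem_dual_idem_eq0 x dr dD hE qE (h := one)).
by apply: q0; rewrite /=; lia.
Qed.

(** E*_i is the dual of [A i], a combination of the [E j], and [E i] is a combination of the [A j];
    the two recurrences then apply. *)
Let gen (W : {vspace V}) : mxstable a W -> mxstable b W -> PQmodule Es E W.
Proof.
case: hq => q [qE q0 qn0] Wa Wb i; split.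
  rewrite /Es dual_idemE; have [t ->] := bm_expand hE (dist_mx_bm C dD i).
  rewrite dual_mx_sum; apply: mxstable_sum.
  exact: (mxstable_dual_mx dD hE qE q0 qn0 (one := one)).
have [s ->] := bm_expand_dist (idem_bm hE i); apply: mxstable_sum => j.
by apply: mxstable_dist_mx dr dD _ Wa _ _; rewrite -ltnS.
Qed.

Lemma TmoduleP (W : {vspace V}) : Tmodule e D x W <-> PQmodule Es E W.
Proof.
split=> [h i|h B].
  split=> w; apply: h; last exact/in_T_bose_mesner/idem_bm.
  by apply: in_T_dual_idem; rewrite -ltnS.
elim=> {B} [B /(bm_expand hE)[t ->]|i iD|c B B' _ IH _ IH'|B B' _ IH _ IH'].
- by apply: mxstable_sum => i; have [] := h i.
- by have [] := h (Ordinal (iD : (i < D.+1)%N)).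
- by move=> w wW; rewrite mulmxDl -scalemxAl rpredD ?rpredZ ?IH ?IH'.
- by move=> w wW; rewrite -mulmxA; apply/IH/IH'.
Qed.

Lemma PQmoduleC (W : {vspace V}) : PQmodule Es E W <-> PQmodule E Es W.
Proof. by split=> h i; have [] := h i. Qed.

Lemma irreducible_TmoduleP (W : {vspace V}) :
  irreducible_Tmodule e D x W <-> PQirreducible Es E W.
Proof. by split=> -[/TmoduleP ? ? irr]; split=> // U /TmoduleP; exact: irr. Qed.

Lemma PQirreducibleC (W : {vspace V}) :
  PQirreducible Es E W <-> PQirreducible E Es W.
Proof. by split=> -[/PQmoduleC ? ? irr]; split=> // U /PQmoduleC; exact: irr. Qed.

Lemma Vdisp_vspan (zeta : int) : Vdisp e x E zeta =
  vspan (fun W => PQirreducible Es E W /\ PQdisp Es E W = zeta).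
Proof. by apply: eq_vspan => W; rewrite irreducible_TmoduleP. Qed.

Lemma Vdisp_vspanC (zeta : int) : Vdisp e x E zeta =
  vspan (fun W => PQirreducible E Es W /\ PQdisp E Es W = - zeta).
Proof.
rewrite Vdisp_vspan; apply: eq_vspan => W; rewrite PQirreducibleC /PQdisp.
by split=> -[? ?]; split=> //; lia.
Qed.

Lemma Vdu_tildeE (i j : int) :
  Vdu_tilde e x E i j = PQtilde Es E i (D%:Z - j).
Proof.
(* Lowering [j] by one raises the [high] index [D - j] by one; once written as [D - (j - 1)], both
   sides are convertible. *)
rewrite /PQtilde -[D%:Z - j + 1]/(D%:Z - j - (- 1)) -addrA -opprD.
by [].
Qed.

Lemma Vud_tildeE (i j : int) :
  Vud_tilde e x E i j = PQtilde E Es j (D%:Z - i).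
Proof.
have capE k l : Vud e x E k l = PQcap E Es l (D%:Z - k) by rewrite /Vud capvC.
rewrite /Vud_tilde !capE /PQtilde addvC; congr (orthoc (_ + PQcap _ _ _ _)%VS _).
lia.
Qed.

Lemma Vdisp_du (zeta : int) : Vdisp e x E zeta =
  (\sum_(i < D.+1) \sum_(j < D.+1 | ((i + j)%N%:Z == D%:Z + zeta)%R)
     Vdu_tilde e x E i%:Z j%:Z)%VS.
Proof.
have [[th thE] [ths thsE]] := (aE, bE).
rewrite Vdisp_vspan (vspan_disp_sum hEs hE' thE thsE aEs bE0 gen).
(* With [k = D - j], the condition [i - k = zeta] becomes [i + j = D + zeta]. *)
apply: eq_bigr => i _; rewrite (reindex_inj rev_ord_inj) /=.
apply: eq_big => [j|j _]; have := ltn_ord j => jD.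
  by apply/eqP/eqP; lia.
by rewrite Vdu_tildeE; congr PQtilde; lia.
Qed.

Lemma Vdisp_ud (zeta : int) : Vdisp e x E zeta =
  (\sum_(i < D.+1) \sum_(j < D.+1 | ((i + j)%N%:Z == D%:Z - zeta)%R)
     Vud_tilde e x E i%:Z j%:Z)%VS.
Proof.
have [[th thE] [ths thsE]] := (aE, bE).
rewrite Vdisp_vspanC (vspan_disp_sum hE' hEs thsE thE bE0 aEs); last first.
  by move=> W Wb Wa; apply/PQmoduleC/gen.
(* In [Vud_tildeE] the [low] index is [j], so the sum over [j] must come outside before [i] is
   reversed. *)
rewrite [RHS](exchange_big_dep xpredT) //=.
apply: eq_bigr => j _; rewrite (reindex_inj rev_ord_inj) /=.
apply: eq_big => [i|i _]; have := ltn_ord i => iD.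
  by apply/eqP/eqP; lia.
by rewrite Vud_tildeE; congr PQtilde; lia.
Qed.

Lemma Vdisp_ortho (zeta eta : int) : zeta != eta ->
  (Vdisp e x E zeta <= orthoC (Vdisp e x E eta))%VS.
Proof.
have [[th thE] [ths thsE]] := (aE, bE); rewrite !Vdisp_vspan.
exact: (vspan_disp_ortho hEs hE' thE thsE aEs bE0 gen).
Qed.

Lemma limg_psi (zeta : int) : limg (psi e x E zeta) = Vdisp e x E zeta.
Proof.
rewrite /psi; set U := Vdisp _ _ _ _; set W := (\sum_(k < _ | _) _)%VS.
(* Disjointness, from mutual orthogonality, makes [daddv_pi] the identity on [U]; hence its image is
   all of [U]. *)
have UW : (U :&: W = 0)%VS.
  apply/eqP; rewrite -subv0 -(capv_orthoC W) capvC capvS //.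
  rewrite orthoC_sym; apply/subv_sumP => k kz.
  exact: Vdisp_ortho.
apply/eqP; rewrite eqEsubv; apply/andP; split; apply/subvP => v.
  by move=> /memv_imgP[w _ ->]; exact: memv_pi.
by move=> vU; rewrite -(daddv_pi_id UW vU) memv_img ?memvf.
Qed.
End Decomposition.

Unset Implicit Arguments.

Theorem theorem3p21 (R : realType) (X : finType) (e : rel X) (D : nat)
    (x : X) (E : 'I_D.+1 -> 'M[R[i]]_#|X|) (zeta : int) :
  distance_regular e -> diam e = D -> (3 <= D)%N ->
  primitive_idempotents e E -> q_polynomial E ->
  - D%:Z <= zeta <= D%:Z ->
  limg (psi e x E zeta) =
    (\sum_(i < D.+1) \sum_(j < D.+1 | ((i + j)%N%:Z == D%:Z + zeta)%R)
        Vdu_tilde e x E i%:Z j%:Z)%VS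
  /\
  limg (psi e x E zeta) =
    (\sum_(i < D.+1) \sum_(j < D.+1 | ((i + j)%N%:Z == D%:Z - zeta)%R)
        Vud_tilde e x E i%:Z j%:Z)%VS.
Proof.
move=> dr dD D3 hE hq _; have D0 : (0 < D)%N by apply: ltn_trans D3.
rewrite (limg_psi x dr dD D0 hE hq); split.
  exact: (Vdisp_du x dr dD D0 hE hq).
exact: (Vdisp_ud x dr dD D0 hE hq).
Qed.
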